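(* Let $m,n\ge 1$, and let $A=(A^{(1)},\dots,A^{(m)})$ and $B=(B^{(1)},\dots,B^{(m)})$ be two $m$-tuples of normal $n\times n$ complex matrices such that the matrices $A^{(1)},\dots,A^{(m)}$ commute with each other and the matrices $B^{(1)},\dots,B^{(m)}$ commute with each other. Let $E=(E^{(1)},\dots,E^{(m)})$ with $E^{(k)}=B^{(k)}-A^{(k)}$ for $k=1,\dots,m$. Let $\alpha_j=(\alpha_j^{(1)},\dots,\alpha_j^{(m)})\in\mathbb{C}^m$ and $\beta_j=(\beta_j^{(1)},\dots,\beta_j^{(m)})\in\mathbb{C}^m$, $j=1,\dots,n$, be the joint eigenvalues (listed with multiplicity) of $A$ and $B$ respectively. If each $A^{(k)}$, $k=1,\dots,m$, is non-singular, then there exists a permutation $\pi$ of $\{1,\dots,n\}$ such that $$\sum_{j=1}^n\sum_{k=1}^m\left|\frac{\alpha_j^{(k)}-\beta_{\pi(j)}^{(k)}}{\alpha_j^{(k)}}\right|^2\le\sum_{k=1}^m\left\|(A^{(k)})^{-1}E^{(k)}\right\|_F^2 .$$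
   Context: $\|\cdot\|_F$ denotes the Frobenius norm. A joint eigenvalue of a tuple $A=(A^{(1)},\dots,A^{(m)})$ of commuting $n\times n$ complex matrices is an element $\lambda=(\lambda^{(1)},\dots,\lambda^{(m)})\in\mathbb{C}^m$ such that there is a non-zero vector $x\in\mathbb{C}^n$ (a joint eigenvector) with $A^{(j)}x=\lambda^{(j)}x$ for all $j=1,\dots,m$. For a commuting tuple $A$ of normal matrices, the list $\alpha_1,\dots,\alpha_n$ of joint eigenvalues with multiplicity means: there is an orthonormal basis $u_1,\dots,u_n$ of $\mathbb{C}^n$ with $A^{(k)}u_j=\alpha_j^{(k)}u_j$ for all $j=1,\dots,n$ and $k=1,\dots,m$; similarly, for $B$ there is an orthonormal basis $v_1,\dots,v_n$ with $B^{(k)}v_j=\beta_j^{(k)}v_j$ for all $j,k$. No commutation between the $A^{(k)}$ and the $B^{(l)}$ is assumed. *)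

(* Defs.v *)
From mathcomp Require Import all_boot all_order all_algebra all_fingroup.
From mathcomp Require Import reals complex.

Set Implicit Arguments.
Unset Strict Implicit.
Unset Printing Implicit Defensive.

Import Order.TTheory GRing.Theory Num.Theory.
Local Open Scope ring_scope.

(* As usual for a norm on a numClosedFieldType, the value is an element of C
   that is real and nonnegative. *)
Definition frobenius_norm (C : numClosedFieldType) (p q : nat)
    (M : 'M[C]_(p, q)) : C :=
  sqrtC (\sum_(i < p) \sum_(j < q) `|M i j| ^+ 2).

Definition commuting_tuple (C : numClosedFieldType) (m n : nat)
    (A : 'I_m -> 'M[C]_n) : Prop :=
  forall k l : 'I_m, comm_mx (A k) (A l).

(* n orthonormal vectors of C^n are linearly independent, hence automatically
   a basis. *)
Definition orthonormal_basis (C : numClosedFieldType) (n : nat)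
    (u : 'I_n -> 'cV[C]_n) : Prop :=
  forall i j : 'I_n, \sum_(r < n) u i r 0 * (u j r 0)^* = (i == j)%:R.

(* [alpha j k] is the k-th coordinate of the j-th joint eigenvalue. *)
Definition joint_eigenvalues (C : numClosedFieldType) (m n : nat)
    (A : 'I_m -> 'M[C]_n) (alpha : 'I_n -> 'I_m -> C) : Prop :=
  exists u : 'I_n -> 'cV[C]_n,
    orthonormal_basis u /\
    forall (j : 'I_n) (k : 'I_m), A k *m u j = alpha j k *: u j.

(* Main.v *)
Require Import Defs.
From mathcomp Require Import all_boot all_order all_algebra all_fingroup.
From mathcomp Require Import reals complex.

Set Implicit Arguments.
Unset Strict Implicit.
Unset Printing Implicit Defensive.

Import Order.TTheory GRing.Theory Num.Theory.
Local Open Scope ring_scope.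

(** Let [P] and [Q] be unitary matrices whose columns are the joint eigenbases
    of [A] and [B], and [W = P^* Q].  Since [A^-1 E = A^-1 B - 1], the matrix
    [P^* (A^(k))^-1 E^(k) Q] has entries
    [(beta_j^(k) / alpha_i^(k) - 1) W_ij], so the right-hand side equals
    [\sum_ij c_ij |W_ij|^2], where [c_ij] is the sum over [k] of the
    squared relative errors between [alpha_i] and [beta_j].  The matrix
    [(|W_ij|^2)] is doubly stochastic, hence by Birkhoff this linear form is at
    least [\sum_i c_(i, pi i)] for some permutation [pi]. *)

(** * Hall's marriage theorem *)

(** Induction on [#|A|], split on whether some nonempty proper subset is tight, i.e. has exactly as
    many neighbours as elements. The function [f0] serves only when [A] is empty, since [T] may be
    empty too. *)
Lemma Hall_marriage (I T : finType) (f0 : I -> T) (N : I -> {set T})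
    (A : {set I}) :
    (forall B : {set I}, B \subset A -> #|B| <= #|\bigcup_(i in B) N i|)%N ->
  exists f : I -> T, {in A, forall i, f i \in N i} /\ {in A &, injective f}.
Proof.
have [k] := ubnP #|A|; elim: k A N => // k IHk A N leAk hall.
have [->|/set0Pn[a aA]] := eqVneq A set0.
  by exists f0; split=> [i|i j]; rewrite inE.
(* It suffices to match a part [B] into [X] and the rest of [A] off [X]. *)
have glue (B : {set I}) (X : {set T}) : B \subset A -> B != set0 ->
    (exists f : I -> T, {in B, forall i, f i \in N i :&: X}
                        /\ {in B &, injective f}) ->
    (forall C : {set I}, C \subset A :\: B ->
       #|C| <= #|\bigcup_(i in C) (N i :\: X)|)%N ->
  exists f : I -> T, {in A, forall i, f i \in N i} /\ {in A &, injective f}.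
  move=> sBA nB0 [f [fN finj]] hallC.
  have [|g [gN ginj]] := IHk (A :\: B) (fun i => N i :\: X) _ hallC.
    rewrite (leq_trans _ (leAk : #|A| <= k)%N) // proper_card // properEneq.
    rewrite subsetDl andbT; apply: contra_neq nB0 => /setDidPl.
    by move/disjoint_setI0; rewrite (setIidPr sBA).
  have gE i : i \in A -> i \notin B -> (g i \in N i) && (g i \notin X).
    by move=> iA iB; have := gN i; rewrite !inE iA iB => /(_ isT)/andP[-> ->].
  have fE i : i \in B -> (f i \in N i) && (f i \in X).
    by move=> /fN; rewrite inE.
  exists (fun i => if i \in B then f i else g i); split=> [i iA|i j iA jA].
    by case: ifPn => iB; [case/andP: (fE i iB)|case/andP: (gE i iA iB)].
  case: ifPn => iB; case: ifPn => jB.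
  - exact: finj.
  - move=> e; case/andP: (fE i iB); case/andP: (gE j jA jB).
    by rewrite e => _ /negP.
  - move=> e; case/andP: (fE j jB); case/andP: (gE i iA iB).
    by rewrite e => _ /negP.
  - by apply: ginj; rewrite !inE ?iA ?jA ?iB ?jB.
have [/existsP[B /and3P[prBA nB0 /eqP tightB]]|/existsPn slack] := boolP
    [exists B : {set I}, [&& B \proper A, B != set0
                           & #|B| == #|\bigcup_(i in B) N i| ]].
  have sBA := proper_sub prBA.
  apply: (glue B (\bigcup_(i in B) N i)) => // [|C sCAB].
    have [||f [fN finj]] := IHk B N.
    - exact: leq_trans (proper_card prBA) leAk.
    - by move=> C sCB; apply: hall; apply: subset_trans sBA.
    exists f; split=> // i iB; rewrite inE fN //=.
    by apply/bigcupP; exists i => //; apply: fN.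
  have /subsetDP[sCA dCB] := sCAB.
  (* Hall's condition for the union of [B] and [C], minus the [#|B|] neighbours of the tight set
     [B], is the condition needed for [C]. *)
  rewrite -(leq_add2l #|B|).
  have -> : (#|B| + #|C| = #|B :|: C|)%N.
    rewrite cardsU (_ : B :&: C = set0) ?cards0 ?subn0 //.
    by apply: disjoint_setI0; rewrite disjoint_sym.
  apply: leq_trans (hall _ _) _; first by rewrite subUset sBA.
  rewrite {1}tightB; apply: leq_trans _ (leq_card_setU _ _).1.
  apply/subset_leq_card/subsetP => t /bigcupP[i iBC tN].
  move: iBC; rewrite !inE => iBC; have [//|tX] := boolP (t \in \bigcup_(i in B) N i).
  case/orP: iBC => [iB|iC]; first by case/bigcupP: tX; exists i.
  by apply/bigcupP; exists i; rewrite // !inE tX.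
(* Without tight sets, [a] may take any neighbour [t]: other nonempty sets have a neighbour to
   spare, so losing [t] is harmless. *)
have /card_gt0P[t tNa] : (0 < #|N a|)%N.
  by have := hall [set a]; rewrite sub1set aA cards1 big_set1; apply.
apply: (glue [set a] [set t]); rewrite ?sub1set //.
- by apply/set0Pn; exists a; rewrite inE.
- exists (fun=> t); split=> [i|i j]; rewrite !inE ?eqxx; last by move=> /eqP-> /eqP->.
  by move/eqP->; rewrite tNa.
move=> C sCA; have [->|nC0] := eqVneq C set0; first by rewrite cards0.
have /subsetD1P[sC aC] := sCA.
have : (#|C| < #|\bigcup_(i in C) N i|)%N.
  have := slack C; rewrite nC0 properEneq sC !andbT ltn_neqAle hall // andbT.
  by rewrite negb_and negbK => /orP[/eqP CA|//]; rewrite CA aA in aC.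
move=> hC; rewrite -ltnS; apply: leq_trans hC _.
rewrite -[X in (_ <= X)%N]add1n -(cards1 t).
apply: leq_trans _ (leq_card_setU _ _).1.
apply/subset_leq_card/subsetP => x /bigcupP[i iC xN].
rewrite !inE; case: eqVneq => //= xt.
by apply/bigcupP; exists i; rewrite // !inE xt.
Qed.

(** * Nonnegative matrices with constant line sums *)

Section ConstantLineSums.
Variables (F : realFieldType) (I : finType).

(** Hall's condition follows by double counting: the rows in [B] have total mass [t * #|B|], all of
    it in the columns of [X], whose total mass is [t * #|X|]. *)
Lemma line_sums_perm_support (t : F) (D : I -> I -> F) : 0 < t ->
    (forall i j, 0 <= D i j) ->
    (forall i, \sum_j D i j = t) -> (forall j, \sum_i D i j = t) ->
  exists s : {perm I}, forall i, 0 < D i (s i).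
Proof.
move=> t0 D0 Drow Dcol.
have [|f [fN finj]] :=
    @Hall_marriage _ _ id (fun i => [set j | 0 < D i j]) [set: I].
  move=> B _; set X := \bigcup_(i in B) _.
  rewrite -(ler_nat F) -(ler_pM2l t0) !mulr_natr -!sumr_const.
  rewrite -(eq_bigr _ (fun i _ => Drow i)) -(eq_bigr _ (fun j _ => Dcol j)).
  rewrite [leRHS]exchange_big /= [leRHS](bigID (mem B)) /=.
  rewrite -[leLHS]addr0 lerD //; last by do 2!apply: sumr_ge0 => ? _.
  apply: ler_sum => i iB; rewrite (bigID (mem X)) /= [X in _ + X]big1 ?addr0 //.
  move=> j jX; apply/eqP; rewrite eq_le D0 andbT leNgt; apply: contra jX => Dij.
  by apply/bigcupP; exists i; rewrite ?inE.
have inj : injective f by move=> i j; apply: finj; rewrite inE.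
by exists (perm inj) => i; rewrite permE; have := fN i; rewrite !inE; apply.
Qed.

(* Optimization form of Birkhoff's theorem: a linear form on doubly stochastic
   matrices is bounded below by one of its values at permutation matrices. *)
Lemma line_sums_min_perm (c D : I -> I -> F) (t : F) :
    (forall i j, 0 <= D i j) ->
    (forall i, \sum_j D i j = t) -> (forall j, \sum_i D i j = t) ->
  exists s : {perm I},
    t * (\sum_i c i (s i)) <= \sum_i \sum_j c i j * D i j.
Proof.
(* Induction on the number of nonzero entries; [t] varies because each step lowers the line sums. *)
have [k] := ubnP #|[set p : I * I | D p.1 p.2 != 0]|.
elim: k t D => // k IHk t D leDk D0 Drow Dcol.
have [i0 _|I0] := pickP I; last first.
  by exists 1%g; rewrite !big_pred0 ?mulr0.
have [t0|nt0] := eqVneq t 0.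
  exists 1%g; rewrite t0 mul0r big1 // => i _; rewrite big1 // => j _.
  have /eqP := Drow i; rewrite t0 psumr_eq0 // => /allP/(_ j).
  by rewrite mem_index_enum => /(_ isT)/eqP->; rewrite mulr0.
have {nt0}t0 : 0 < t by rewrite lt_neqAle eq_sym nt0 -(Drow i0) sumr_ge0.
have [s sD] := line_sums_perm_support t0 D0 Drow Dcol.
(* The least entry along [s] is the largest multiple of its permutation matrix that can be
   subtracted with all entries staying nonnegative; the entry at [(m, s m)] becomes zero. *)
pose m := [arg min_(i < i0) D i (s i)]%O; pose a := D m (s m).
have a_min i : a <= D i (s i).
  by rewrite /a /m; case: arg_minP => // x _ xmin; apply: xmin.
pose D' i j := D i j - a * (j == s i)%:R.
have delta_row (g : I -> F) i : \sum_j g j * (j == s i)%:R = g (s i).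
  rewrite (bigD1 (s i)) //= eqxx mulr1 big1 ?addr0 // => j /negPf->.
  exact: mulr0.
have D'0 i j : 0 <= D' i j.
  by rewrite /D'; case: eqP => [->|_]; rewrite ?mulr0 ?subr0 ?mulr1 ?subr_ge0.
have D'row i : \sum_j D' i j = t - a.
  by rewrite sumrB Drow (delta_row (fun=> a)).
have D'col j : \sum_i D' i j = t - a.
  rewrite sumrB Dcol (bigD1 (s^-1 j)%g) //= permKV eqxx mulr1 big1 ?addr0 //.
  move=> i; have [->|_ _] := eqVneq j (s i); last by rewrite mulr0.
  by rewrite permK eqxx.
have {}leDk : (#|[set p : I * I | D' p.1 p.2 != 0%R]| < k)%N.
  apply: leq_trans (leDk : (_ <= k)%N); apply: proper_card; apply/properP; split.
    apply/subsetP => -[i j]; rewrite !inE /=; apply: contra_neq => Dij.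
    rewrite /D' Dij; case: eqP => [ij|_]; last by rewrite mulr0 subr0.
    by have := sD i; rewrite -ij Dij ltxx.
  exists (m, s m); rewrite !inE /=; first by rewrite gt_eqF.
  by rewrite /D' eqxx mulr1 subrr eqxx.
have [s' s'P] := IHk _ _ leDk D'0 D'row D'col.
have split_cost : \sum_i \sum_j c i j * D i j =
    a * (\sum_i c i (s i)) + \sum_i \sum_j c i j * D' i j.
  rewrite mulr_sumr -big_split; apply: eq_bigr => i _ /=.
  rewrite -(delta_row (c i)) mulr_sumr -big_split; apply: eq_bigr => j _ /=.
  by rewrite /D' mulrBr [a * _]mulrCA addrC subrK.
have a0 : 0 <= a by exact: D0.
have ta0 : 0 <= t - a by rewrite -(D'row i0) sumr_ge0.
have tE x : t * x = a * x + (t - a) * x by rewrite -mulrDl addrC subrK.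
rewrite split_cost.
(* The cheaper of [s] and [s'] bounds both terms, of weights [a] and [t - a]. *)
have [le|/ltW le] := leP (\sum_i c i (s i)) (\sum_i c i (s' i)).
  by exists s; rewrite tE lerD2l (le_trans _ s'P) // ler_wpM2l.
by exists s'; rewrite tE lerD // ler_wpM2l.
Qed.

End ConstantLineSums.

(** * Frobenius norm and joint eigenbases *)

Section JointEigenbases.
Variables (C : numClosedFieldType) (m n : nat).
Local Open Scope sesquilinear_scope.

Lemma frobenius_norm_sqr (M : 'M[C]_n) :
  frobenius_norm M ^+ 2 = \sum_i \sum_j `|M i j| ^+ 2.
Proof. exact: sqrtCK. Qed.

Lemma frobenius_norm_sqr_tr (M : 'M[C]_n) :
  frobenius_norm M ^+ 2 = \tr (M *m M^t*).
Proof.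
rewrite frobenius_norm_sqr; apply: eq_bigr => i _.
by rewrite mxE; apply: eq_bigr => j _; rewrite !mxE normCK.
Qed.

Lemma frobenius_norm_sqr_unitary (P Q M : 'M[C]_n) :
    P \is unitarymx -> Q \is unitarymx ->
  frobenius_norm (P *m M *m Q) ^+ 2 = frobenius_norm M ^+ 2.
Proof.
move=> Pu Qu; rewrite !frobenius_norm_sqr_tr !(trmx_mul, map_mxM) !mulmxA.
rewrite mulmxtVK // mxtrace_mulC !mulmxA.
by rewrite -(invmx_unitary Pu) mulVmx ?unitarymx_unit // mul1mx.
Qed.

Lemma unitary_row_sum (W : 'M[C]_n) : W \is unitarymx ->
  forall i, \sum_j `|W i j| ^+ 2 = 1.
Proof.
move=> /unitarymxP/matrixP + i => /(_ i i).
rewrite !mxE eqxx => WWii; rewrite -[RHS]WWii.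
by apply: eq_bigr => j _; rewrite !mxE normCK.
Qed.

Lemma unitary_col_sum (W : 'M[C]_n) : W \is unitarymx ->
  forall j, \sum_i `|W i j| ^+ 2 = 1.
Proof.
rewrite -trmx_unitary => /unitary_row_sum + j => /(_ j) <-.
by apply: eq_bigr => i _; rewrite mxE.
Qed.

Lemma joint_eigenvalues_diag (A : 'I_m -> 'M[C]_n) (a : 'I_n -> 'I_m -> C) :
    joint_eigenvalues A a ->
  exists2 P : 'M[C]_n, P \is unitarymx &
    forall k, A k *m P = P *m diag_mx (\row_j a j k).
Proof.
move=> [u [u_on uA]]; exists (\matrix_(i, j) u j i 0).
  (* The vectors [u j] are the rows of the transpose, so orthonormality is directly its
     unitarity. *)
  rewrite -trmx_unitary; apply/unitarymxP/matrixP => i j; rewrite !mxE -u_on.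
  by apply: eq_bigr => r _; rewrite !mxE.
move=> k; apply/matrixP => i j; rewrite mul_mx_diag !mxE mulrC.
have /matrixP/(_ i 0) := uA j k; rewrite !mxE => <-.
by apply: eq_bigr => r _; rewrite mxE.
Qed.

(** Otherwise the unit vector [u j] would lie in the kernel of [A k]. *)
Lemma joint_eigenvalues_neq0 (A : 'I_m -> 'M[C]_n) (a : 'I_n -> 'I_m -> C) j k :
  joint_eigenvalues A a -> A k \in unitmx -> a j k != 0.
Proof.
move=> [u [u_on uA]] Ak; apply/eqP => a0.
have uj0 : u j = 0 by rewrite -[u j](mulKmx Ak) uA a0 scale0r mulmx0.
have /eqP := u_on j j; rewrite eqxx big1 ?(eq_sym 0) ?oner_eq0 // => r _.
by rewrite uj0 mxE mul0r.
Qed.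

(* The unitary matrix [W] is the change of basis between the two joint
   eigenbases. *)
Lemma relative_perturbation_expansion (A B : 'I_m -> 'M[C]_n)
    (a b : 'I_n -> 'I_m -> C) :
    joint_eigenvalues A a -> joint_eigenvalues B b ->
    (forall k, A k \in unitmx) ->
  exists2 W : 'M[C]_n, W \is unitarymx & forall k,
    frobenius_norm (invmx (A k) *m (B k - A k)) ^+ 2
      = \sum_i \sum_j `|(a i k - b j k) / a i k| ^+ 2 * `|W i j| ^+ 2.
Proof.
move=> hA hB Au.
have [P Pu AP] := joint_eigenvalues_diag hA.
have [Q Qu BQ] := joint_eigenvalues_diag hB.
have Pcu : P^t* \is unitarymx by rewrite trmxC_unitary.
exists (P^t* *m Q) => [|k]; first exact: mul_unitarymx.
rewrite -(frobenius_norm_sqr_unitary _ Pcu Qu) frobenius_norm_sqr.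
set W := P^t* *m Q; set X := P^t* *m _ *m Q.
set Da := diag_mx (\row_j a j k); set Db := diag_mx (\row_j b j k).
have PA : P^t* *m A k = Da *m P^t*.
  rewrite -[LHS](mulmxtVK _ Pu) -[_ *m A k *m P]mulmxA AP !mulmxA.
  by rewrite -(invmx_unitary Pu) mulVmx ?unitarymx_unit // mul1mx.
(* Multiplying by [Da] cancels the inverse of [A k]; entrywise this reads
   [a i k * X i j = (b j k - a i k) * W i j]. *)
have DX : Da *m X = W *m Db - Da *m W.
  rewrite /X /W !mulmxA -PA -[_ *m Q *m Db]mulmxA -BQ mulmxA.
  by rewrite mulmxK // mulmxBr mulmxBl.
apply: eq_bigr => i _; apply: eq_bigr => j _.
have a0 : a i k != 0 := joint_eigenvalues_neq0 i hA (Au k).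
rewrite -exprMn -normrM -[in RHS]normrN; congr (`|_| ^+ 2).
apply: (mulfI a0).
clearbody W X; have /matrixP/(_ i j) := DX.
rewrite !mul_diag_mx mul_mx_diag !mxE => ->.
by rewrite mulrN mulrA [_ * (_ / _)]mulrC divfK // mulrBl opprB [W i j * _]mulrC.
Qed.

End JointEigenbases.

Theorem theorem3p3 (R : realType) (m n : nat) (hm : (0 < m)%N) (hn : (0 < n)%N)
    (A B E : 'I_m -> 'M[R[i]]_n)
    (hAnormal : forall k : 'I_m, A k \is normalmx)
    (hBnormal : forall k : 'I_m, B k \is normalmx)
    (hAcomm : commuting_tuple A)
    (hBcomm : commuting_tuple B)
    (hE : forall k : 'I_m, E k = B k - A k)
    (alpha beta : 'I_n -> 'I_m -> R[i])
    (halpha : joint_eigenvalues A alpha)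
    (hbeta : joint_eigenvalues B beta)
    (hAunit : forall k : 'I_m, A k \in unitmx) :
  exists pi : 'S_n,
    \sum_(j < n) \sum_(k < m) `|(alpha j k - beta (pi j) k) / alpha j k| ^+ 2
      <= \sum_(k < m) frobenius_norm (invmx (A k) *m E k) ^+ 2.
Proof.
have [W Wu normE] := relative_perturbation_expansion halpha hbeta hAunit.
(* The order on [R[i]] is only partial, while the Birkhoff argument needs a totally ordered field;
   squared moduli are therefore taken in [R] and embedded back. *)
pose sqn (z : R[i]) : R := complex.Re `|z| ^+ 2.
have sqnE z : `|z| ^+ 2 = (sqn z)%:C%C.
  by rewrite rmorphXn; congr (_ ^+ 2); rewrite (RRe_real (normr_real z)).
pose c i j := \sum_k sqn ((alpha i k - beta j k) / alpha i k).
have [||| s sP] := @line_sums_min_perm _ _ c (fun i j => sqn (W i j)) 1.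
- by move=> i j; rewrite sqr_ge0.
- move=> i; apply: complexI; rewrite rmorph_sum rmorph1 -(unitary_row_sum Wu i).
  by apply: eq_bigr => j _; rewrite sqnE.
- move=> j; apply: complexI; rewrite rmorph_sum rmorph1 -(unitary_col_sum Wu j).
  by apply: eq_bigr => i _; rewrite sqnE.
exists s.
have -> : \sum_(k < m) frobenius_norm (invmx (A k) *m E k) ^+ 2
    = (\sum_i \sum_j c i j * sqn (W i j))%:C%C.
  under eq_bigr do rewrite hE normE.
  rewrite exchange_big rmorph_sum; apply: eq_bigr => i _.
  rewrite exchange_big rmorph_sum; apply: eq_bigr => j _.
  rewrite rmorphM rmorph_sum mulr_suml; apply: eq_bigr => k _.
  by rewrite !sqnE.
have -> : \sum_(j < n) \sum_(k < m)
      `|(alpha j k - beta (s j) k) / alpha j k| ^+ 2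
    = (\sum_j c j (s j))%:C%C.
  rewrite rmorph_sum; apply: eq_bigr => j _; rewrite rmorph_sum.
  by apply: eq_bigr => k _; rewrite sqnE.
by rewrite lecR -[leLHS]mul1r.
Qed.
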